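(* Let $\Lambda$ be a finitely generated free abelian group, let $\Gamma:\Lambda\times\Lambda\to\mathbb{Z}$ be a unimodular symmetric bilinear form, and let $A(\Gamma)$ be its automorphism group. (1) $A(\Gamma)$ is finite if and only if $\Gamma$ is definite, or $\Gamma$ is indefinite of rank $2$. (2) Suppose $A(\Gamma)$ is infinite, i.e. $\Gamma$ is indefinite of rank at least $3$. Let $D\subseteq A(\Gamma)$ be a subgroup. If there is a nonempty finite set of nonzero characteristic elements of $\Lambda$ that is preserved (as a set) by $D$, then $D$ has infinite index in $A(\Gamma)$.
   Context: $A(\Gamma)$ is the group of automorphisms of $\Lambda$ preserving $\Gamma$. The rank of $\Gamma$ is the rank of $\Lambda$. Let $b^+$, $b^-$ be the numbers of $+1$'s and $-1$'s in a diagonalization of $\Gamma$ over $\mathbb{R}$; $\Gamma$ is definite if $\min\{b^+,b^-\}=0$ and indefinite otherwise. An element $x\in\Lambda$ is characteristic if $\Gamma(x,y)\equiv\Gamma(y,y)\pmod 2$ for all $y\in\Lambda$. *)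

(* Defs.v *)
From mathcomp Require Import all_boot all_order all_algebra.
From mathcomp Require Import boolp classical_sets functions cardinality reals.

Set Implicit Arguments.
Unset Strict Implicit.
Unset Printing Implicit Defensive.

Import GRing.Theory Num.Theory.
Local Open Scope ring_scope.
Local Open Scope classical_set_scope.

Definition is_Zbasis (Lambda : zmodType) (n : nat) (e : 'I_n -> Lambda) : Prop :=
  forall x : Lambda, exists! c : {ffun 'I_n -> int}, x = \sum_i e i *~ c i.

(* [Lambda] is finitely generated free iff [free_of_rank Lambda n] holds for
   some [n]; this [n] is then its rank. *)
Definition free_of_rank (Lambda : zmodType) (n : nat) : Prop :=
  exists e : 'I_n -> Lambda, is_Zbasis e.

Section Forms.
Variables (Lambda : zmodType) (Gamma : Lambda -> Lambda -> int).

(* Between abelian groups, additivity in each argument is Z-bilinearity. *)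
Definition is_bilinear_form : Prop :=
  (forall y, zmod_morphism (Gamma^~ y)) /\ (forall x, zmod_morphism (Gamma x)).

Definition is_symmetric_form : Prop := forall x y, Gamma x y = Gamma y x.

(* The adjoint map [x |-> Gamma x] from [Lambda] to [Hom(Lambda, Z)] is
   bijective. *)
Definition is_unimodular : Prop :=
  forall f : Lambda -> int, zmod_morphism f ->
    exists! x : Lambda, forall y, Gamma x y = f y.

Definition gram (n : nat) (e : 'I_n -> Lambda) : 'M[int]_n :=
  \matrix_(i, j) Gamma (e i) (e j).

(* The rows of [P] are the coordinates, with respect to a Z-basis [e] of
   [Lambda], of a basis of the real vector space [R (x) Lambda] in which the
   real extension of [Gamma] has the diagonal matrix with entries [d]. *)
Definition diagonalization (R : realType) (n : nat) (d : 'rV[R]_n) : Prop :=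
  (forall i, d 0 i = 1 \/ d 0 i = -1) /\
  exists e : 'I_n -> Lambda, exists P : 'M[R]_n,
    [/\ is_Zbasis e, P \in unitmx
      & P *m map_mx intr (gram e) *m P^T = diag_mx d].

(* [bp] and [bm] are the numbers b^+ and b^- of [Gamma]. *)
Definition signature (R : realType) (bp bm : nat) : Prop :=
  exists n (d : 'rV[R]_n),
    [/\ diagonalization d,
        bp = #|[pred i | d 0 i == 1]| & bm = #|[pred i | d 0 i == -1]|].

Definition definite (R : realType) : Prop :=
  exists bp bm, signature R bp bm /\ minn bp bm = 0%N.

Definition indefinite (R : realType) : Prop := ~ definite R.

(* The group A(Gamma); its group law is composition. *)
Definition autgrp : set (Lambda -> Lambda) :=
  [set f | [/\ zmod_morphism f, bijective f
             & forall x y, Gamma (f x) (f y) = Gamma x y]].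

Definition characteristic (x : Lambda) : Prop :=
  forall y, (Gamma x y = Gamma y y %[mod 2])%Z.

End Forms.

Section FunctionGroups.
Variables (T : Type) (A D : set (T -> T)).

(* [A] is meant to be a group of bijections of [T] under composition. *)
Definition is_subgroup : Prop :=
  [/\ D `<=` A, D id,
      forall f g, D f -> D g -> D (f \o g)
    & forall f g, D f -> cancel f g -> cancel g f -> D g].

Definition left_cosets : set (set (T -> T)) :=
  [set [set f \o d | d in D] | f in A].

Definition infinite_index : Prop := infinite_set left_cosets.

End FunctionGroups.

(* Main.v *)
From HB Require Import structures.
Require Import Defs.
From mathcomp Require Import all_boot all_order all_algebra.
From mathcomp Require Import boolp classical_sets functions cardinality reals.
From mathcomp Require Import ring lra zify.

(* For [a, b] in [Lambda] let [J x = (x.a) b - (x.b) a], a skew endomorphism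
   with [J ^ 3 = D J], where [D = (a.b) ^ 2 - (a.a) (b.b)]. Every solution of
   [t ^ 2 - D u ^ 2 = 1] gives the isometry [1 + 2 t u J + 2 u ^ 2 J ^ 2].
   In an indefinite form choose [a.a > 0 > b.b], so that [D > 0]. If [D] is not
   a square, Pell's equation has infinitely many solutions and the isometries
   move every [x] with [J x <> 0] infinitely often. If [D] is a square, the
   plane of [a] and [b] contains an isotropic vector [e]; taking [a := e] and
   [b] orthogonal to [e] gives [D = 0], [t = 1] and [u] arbitrary (Eichler
   transvections). From rank 3 on, one of these two families gives every
   nonzero vector an infinite orbit, whence both infinite claims. Conversely,
   an automorphism is determined by the numbers [f v_i . v_j] for a
   nondegenerate family [v]; these are bounded by Cauchy-Schwarz if the form is
   definite, and in the indefinite rank 2 case, where unimodularity makes [D] a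
   square, by taking for [v] two isotropic vectors. *)

Set Implicit Arguments.
Unset Strict Implicit.
Unset Printing Implicit Defensive.

Import Order.TTheory GRing.Theory Num.Theory.
Local Open Scope ring_scope.
Local Open Scope classical_set_scope.

(** * Finiteness by encoding into finite types *)

Lemma finite_set_inj (T : Type) (U : finType) (A : set T) (f : T -> U) :
  {in A &, injective f} -> finite_set A.
Proof.
move=> f_inj; have ffin : finite_set (f @` A) by apply: finite_finset.
have := @finite_preimage _ _ _ (fun x : {x | A x} => f (sval x)).
move=> /(_ [set: U]) h.
have sfin : finite_set [set: {x | A x}].
  have -> : [set: {x | A x}] = (fun x : {x | A x} => f (sval x)) @^-1` [set: U].
    by rewrite preimage_setT.
  apply: h; last exact: finite_finset.
  move=> [x Ax] [y Ay] _ _ /= fxy.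
  have xy : x = y by apply: f_inj => //; apply/mem_set.
  by subst y; congr exist; apply: Prop_irrelevance.
have -> : A = (fun x : {x | A x} => sval x) @` setT.
  apply/seteqP; split=> [x Ax|x [[y Ay] _ <-//]].
  by exists (exist _ x Ax).
exact: finite_image.
Qed.

(** The shift by [M] keeps both arguments in the range where [inord] does not fall back on its
    default value. Both pigeonhole arguments below encode bounded integers this way. *)
Lemma inord_shift_inj (M : nat) (x y : int) : `|x| <= M%:Z -> `|y| <= M%:Z ->
  inord (absz (x + M%:Z)) = inord (absz (y + M%:Z)) :> 'I_(M + M).+1 -> x = y.
Proof.
move=> xM yM /(congr1 val) /=.
rewrite !inordK; lia.
Qed.

(** * Pell's equation *)

(** Since [q ^ 2] divides [p ^ 2], [q] divides [p]: an integer that is a rational square is an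
    integral square. *)
Lemma int_sqr_quotient (D p q : int) :
  q != 0 -> p ^+ 2 = D * q ^+ 2 -> exists s, s ^+ 2 = D.
Proof.
move=> q0 pq.
have : (q %| p)%Z.
  by rewrite dvdzE -(@dvdn_pexp2r _ _ 2) // -!abszX -dvdzE pq dvdz_mull.
move=> /dvdzP [s ps]; exists s.
apply: (mulIf (expf_neq0 2 q0)).
by rewrite -pq ps exprMn.
Qed.

Section Pell.
Variables (D : int).
Hypothesis D_gt0 : 0 < D.
Hypothesis D_nonsquare : forall s : int, s ^+ 2 != D.

(** Pigeonhole: of the [N + 2] fractional parts of [q sqrt D] with [0 <= q <= N + 1], two lie in the
    same of [N + 1] intervals of length [1 / (N + 1)]. *)
Lemma dirichlet_sqrt (R : realType) (N : nat) : exists p q : int,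
  [/\ 0 <= p, 0 < q, q <= N.+1%:Z &
      `|p%:~R - q%:~R * Num.sqrt D%:~R| < (N.+1%:R : R)^-1].
Proof.
set s : R := Num.sqrt D%:~R.
have s2 : s ^+ 2 = D%:~R by rewrite sqr_sqrtr // ler0z ltW.
have s1 : 1 <= s.
  have D1 : 1 <= D%:~R :> R by rewrite ler1z; lia.
  by rewrite -[leLHS]sqrtr1 ler_wsqrtr.
pose r (q : nat) : R := q%:R * s - (Num.floor (q%:R * s))%:~R.
have r01 q : 0 <= r q < 1.
  have := floor_itv (q%:R * s); rewrite /r intrD.
  by move=> /andP[h1 h2]; rewrite subr_ge0 h1 /=; lra.
pose c (q : 'I_N.+2) : 'I_N.+1 := inord (absz (Num.floor (r q * N.+1%:R))).
have cle (q : 'I_N.+2) : (Num.floor (r q * N.+1%:R)) = (c q)%:Z.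
  have /andP[r0 r1] := r01 (q : nat).
  have f0 : 0 <= Num.floor (r q * N.+1%:R) by rewrite floor_ge0 mulr_ge0.
  rewrite /c inordK; first lia.
  have : Num.floor (r q * N.+1%:R) < N.+1%:Z.
    by rewrite -(ltr_int R); apply: le_lt_trans (floor_le _) _; rewrite gtr_pMl // ltr0n.
  lia.
have : ~ injective c.
  by move=> /leq_card; rewrite !card_ord ltnn.
move=> /existsNP [q1] /existsNP [q2] /not_implyP [cq /eqP q12].
wlog lq : q1 q2 cq q12 / (q1 < q2)%N.
  move=> W; case: (ltngtP q1 q2) => [|h|h]; first exact: W.
    by apply: (W q2 q1) => //; rewrite eq_sym.
  by case/eqP: q12; apply: val_inj.
pose p := Num.floor (q2%:R * s) - Num.floor (q1%:R * s).
exists p, (q2%:Z - q1%:Z).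
have N0 : (0 : R) < N.+1%:R by rewrite ltr0n.
have bd : `|p%:~R - (q2%:Z - q1%:Z)%:~R * s| < N.+1%:R^-1.
  have -> : p%:~R - (q2%:Z - q1%:Z)%:~R * s = r q1 - r q2.
    by rewrite /p /r !intrB -!pmulrn; ring.
  rewrite -[X in _ < X]mul1r ltr_pdivlMr //.
  rewrite -[X in _ * X]ger0_norm ?ltW // -normrM mulrBl.
  have h1 := floor_itv (r q1 * N.+1%:R).
  have h2 := floor_itv (r q2 * N.+1%:R).
  move: h1 h2; rewrite !cle cq intrD mulr1z.
  move=> /andP[a1 a2] /andP[b1 b2].
  by rewrite ltr_norml; apply/andP; split; lra.
split=> //; [|lia|have := ltn_ord q2; lia].
have Ninv : N.+1%:R^-1 <= 1 :> R by rewrite invf_le1 // ler1n.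
have : (-1 : R) < p%:~R.
  have d1 : 1 <= (q2%:Z - q1%:Z)%:~R :> R by rewrite ler1z; lia.
  have d2 : 1 <= (q2%:Z - q1%:Z)%:~R * s by rewrite -[leLHS]mulr1; apply: ler_pM.
  move: bd; rewrite ltr_norml => /andP[b1 b2].
  move: d2 b1 Ninv; set X := _ * s; set Y := _^-1 => *; lra.
by rewrite (_ : -1 = (-1)%:~R) // ltr_int; lia.
Qed.

(** The norm factors as [(p - q sqrt D) (p + q sqrt D)]. In absolute value the first factor is below
    [1 / (N + 1)] and the second at most [1 + 2 (N + 1) D], whence the bound [2 D + 1]. *)
Lemma small_norm_unbounded (R : realType) (K : nat) : exists p q : int,
  [/\ 0 <= p, 0 < q, `|p ^+ 2 - D * q ^+ 2| <= 2 * D + 1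
    & ~ (p <= K%:Z /\ q <= K%:Z)].
Proof.
(* Makes [N + 1 = K (1 + D) + 2] exceed [p + q sqrt D] whenever [p, q <= K]. The norm would then be
   an integer of absolute value below 1, so 0, and [D] a square. *)
pose N := absz (K%:Z * (1 + D) + 1).
have [p [q [p0 q0 qN bd]]] := dirichlet_sqrt R N.
exists p, q.
move: bd; set s : R := Num.sqrt D%:~R => bd.
have s2 : s ^+ 2 = D%:~R by rewrite sqr_sqrtr // ler0z ltW.
have s0 : 0 <= s by apply: sqrtr_ge0.
have D1 : 1 <= D%:~R :> R by rewrite ler1z; lia.
have sD : s <= D%:~R.
  rewrite -(@ler_pXn2r _ 2) ?nnegrE //; last by lra.
  by rewrite s2 expr2 -[leLHS]mulr1 ler_pM //; lra.
have NE : N.+1%:R = K%:R * (1 + D%:~R) + 2 :> R.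
  rewrite pmulrn (_ : N.+1%:Z = K%:Z * (1 + D) + 2); last by rewrite /N; nia.
  by rewrite intrD intrM intrD.
have p0R : 0 <= p%:~R :> R by rewrite ler0z.
have q0R : 1 <= q%:~R :> R by rewrite ler1z; lia.
have N0 : (0 : R) < N.+1%:R by rewrite ltr0n.
have qs0 : 0 <= q%:~R * s by rewrite mulr_ge0 // (le_trans _ q0R).
have nE : (p ^+ 2 - D * q ^+ 2)%:~R = (p%:~R - q%:~R * s) * (p%:~R + q%:~R * s).
  by rewrite intrB intrM !rmorphXn /= -s2; ring.
have pq0 : 0 <= p%:~R + q%:~R * s by rewrite addr_ge0.
have nR : `|p ^+ 2 - D * q ^+ 2|%:~R <= N.+1%:R^-1 * (p%:~R + q%:~R * s) :> R.
  by rewrite intr_norm nE normrM [X in _ * X <= _]ger0_norm // ler_wpM2r // ltW.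
split=> //.
  rewrite -(ler_int R); apply: le_trans nR _.
  have Ninv : N.+1%:R^-1 <= 1 :> R by rewrite invf_le1 // ler1n.
  have pb : p%:~R + q%:~R * s <= 1 + 2 * N.+1%:R * D%:~R.
    have h : q%:~R * s <= N.+1%:R * D%:~R.
      by apply: ler_pM => //; [lra | rewrite pmulrn ler_int].
    move: bd; rewrite ltr_norml => /andP[_ b1].
    move: h b1 Ninv; set X := _ * s; set Y := _^-1 => *; lra.
  apply: (le_trans (ler_wpM2l _ pb)); first by rewrite invr_ge0 ltW.
  rewrite mulrDr mulr1 mulrA mulrCA mulVf ?gt_eqF // mulr1 intrD intrM addrC.
  by rewrite lerD.
move=> [pK qK].
have : 1 <= `|p ^+ 2 - D * q ^+ 2|.
  suff : p ^+ 2 - D * q ^+ 2 != 0 by rewrite -normr_gt0 gtz0_ge1.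
  apply/eqP => /eqP; rewrite subr_eq0 => /eqP /int_sqr_quotient [|t tD].
    by rewrite gt_eqF.
  by move: (D_nonsquare t); rewrite tD eqxx.
rewrite -(ler_int R) => /le_trans /(_ nR).
rewrite mulrC ler_pdivlMr // mul1r NE; apply/negP; rewrite -ltNge.
have : p%:~R <= K%:R :> R by rewrite pmulrn ler_int.
have : q%:~R * s <= K%:R * D%:~R.
  by apply: ler_pM => //; [lra | rewrite pmulrn ler_int].
by rewrite mulrDr mulr1; set X := _ * s; set Y := _ * _ => *; lra.
Qed.

(* Two solutions of [p ^ 2 - D q ^ 2 = m] that agree modulo [m] have a quotient
   with integral coordinates. *)
Lemma pell_solution (R : realType) : exists t u : int,
  [/\ 0 < t, 0 < u & t ^+ 2 - D * u ^+ 2 = 1].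
Proof.
pose S := [set z : int * int | [/\ 0 <= z.1, 0 < z.2 &
  `|z.1 ^+ 2 - D * z.2 ^+ 2| <= 2 * D + 1]].
have Sinf : ~ finite_set S.
  move=> /finite_seqP [r Sr].
  have [K KP] : exists K : nat, forall z, z \in r -> z.1 <= K%:Z /\ z.2 <= K%:Z.
    elim: r {Sr} => [|z r [K KP]]; first by exists 0%N.
    exists (K + (absz z.1 + absz z.2))%N => w.
    by rewrite inE => /orP[/eqP ->|/KP]; lia.
  have [p [q [p0 q0 n1 n2]]] := small_norm_unbounded R K.
  by apply: n2; apply: (KP (p, q)); have : S (p, q) by []; rewrite Sr.
pose M := absz (2 * D + 1).
pose nm (z : int * int) := z.1 ^+ 2 - D * z.2 ^+ 2.
pose i (x : int) : 'I_(M + M).+1 := inord (absz (x + M%:Z)).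
pose f z := (i (nm z), i (z.1 %% nm z)%Z, i (z.2 %% nm z)%Z).
have nm0 z : S z -> nm z != 0.
  move=> [_ z2 _]; rewrite subr_eq0; apply/eqP => /int_sqr_quotient [|t tD].
    by rewrite gt_eqF.
  by move: (D_nonsquare t); rewrite tD eqxx.
have : ~ {in S &, injective f}.
  by move=> /finite_set_inj.
(* Without a solution, two pairs of the same class coincide, so that [f] would embed the infinite
   set [S] into a finite type. *)
move=> h; apply: contrapT => nex; apply: h.
move=> z w /set_mem Sz /set_mem Sw [].
have nz := nm0 _ Sz; have nw := nm0 _ Sw.
case: (Sz) => z1 z2 z3; case: (Sw) => w1 w2 w3.
have MD : M%:Z = 2 * D + 1 by rewrite /M; lia.
have modM x y : x != 0 -> `|x| <= M%:Z -> `|(y %% x)%Z| <= M%:Z.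
  by move=> x0 xM; rewrite ger0_norm ?modz_ge0 // (le_trans _ xM) // ltW // ltz_mod.
move=> /inord_shift_inj e1; have {e1} e1 : nm z = nm w by apply: e1; rewrite MD.
move=> /inord_shift_inj e2; have {e2} e2 : (z.1 %% nm z)%Z = (w.1 %% nm w)%Z.
  by apply: e2; apply: modM => //; rewrite MD.
move=> /inord_shift_inj e3; have {e3} e3 : (z.2 %% nm z)%Z = (w.2 %% nm w)%Z.
  by apply: e3; apply: modM => //; rewrite MD.
move: e2 e3; rewrite -e1 => /eqP; rewrite eq_sym eqz_mod_dvd => /dvdzP [k kE].
move=> /eqP; rewrite eq_sym eqz_mod_dvd => /dvdzP [l lE].
case: z w Sz Sw nz nw z1 z2 z3 w1 w2 w3 e1 kE lE => p q [p' q'] /= _ _.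
rewrite /nm /=; set m := p ^+ 2 - D * q ^+ 2 => m0 _ p0 q0 mM p0' q0' _ mE kE lE.
have pE : p' = p + k * m by rewrite -kE; ring.
have qE : q' = q + l * m by rewrite -lE; ring.
(* [t + u sqrt D] is the quotient of [p' + q' sqrt D] by [p + q sqrt D], with the division by [m]
   already carried out. *)
pose t := 1 + p * k - D * q * l; pose u := p * l - k * q.
have tm : t * m = p * p' - D * q * q' by rewrite pE qE /t /m; ring.
have um : u * m = p * q' - p' * q by rewrite pE qE /u /m; ring.
have tu : t ^+ 2 - D * u ^+ 2 = 1.
  apply: (mulIf (expf_neq0 2 m0)).
  have -> : (t ^+ 2 - D * u ^+ 2) * m ^+ 2 = (t * m) ^+ 2 - D * (u * m) ^+ 2 by ring.
  have -> : m ^+ 2 = m * (p' ^+ 2 - D * q' ^+ 2) by rewrite -mE expr2.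
  by rewrite tm um mul1r /m; ring.
(* If [u = 0], the two pairs are proportional; having the same norm and no negative coordinate, they
   are equal. *)
have [u0|u0] := eqVneq u 0.
  have e : p * q' = p' * q by apply/eqP; rewrite -subr_eq0 -um u0 mul0r.
  have : m * (q' ^+ 2 - q ^+ 2) = (p * q') ^+ 2 - (p' * q) ^+ 2.
    rewrite mulrBr {2}mE /m; ring.
  rewrite e subrr => /eqP; rewrite mulf_eq0 (negPf m0) /= subr_eq0.
  rewrite eqrXn2 ?ltW // => /eqP qq'.
  move: e; rewrite qq' => /mulIf; rewrite gt_eqF // => /(_ isT) ->.
  by [].
case: nex; exists `|t|, `|u|; rewrite !real_normK ?num_real // normr_gt0.
split=> //; last by rewrite normr_gt0.
apply/eqP => t0; have : 0 <= D * u ^+ 2 by rewrite mulr_ge0 ?sqr_ge0 // ltW.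
by move: tu; rewrite t0 expr0n; lia.
Qed.

(** The powers of one solution [t1 + u1 sqrt D] have strictly increasing second coordinates. Squares
    are compared because [u ^ 2] is what the orbit argument separates. *)
Lemma pell_sequence (R : realType) : exists t u : nat -> int,
  (forall k, t k ^+ 2 - D * u k ^+ 2 = 1) /\
  (forall i j, u i ^+ 2 = u j ^+ 2 -> i = j).
Proof.
have [t1 [u1 [t1_gt0 u1_gt0 tu1]]] := pell_solution R.
pose st (z : int * int) := (t1 * z.1 + D * u1 * z.2, t1 * z.2 + u1 * z.1).
pose z k := iter k st (1, 0).
have zP k : [/\ (z k).1 ^+ 2 - D * (z k).2 ^+ 2 = 1, 0 < (z k).1 & 0 <= (z k).2].
  elim: k => [|k]; first by rewrite /z /= expr1n expr0n mulr0 subr0.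
  rewrite /z /= -/(z k); case: (z k) => t u [/= tu t0 u0]; split.
  - rewrite -[RHS]mul1r -{1}tu1 -tu; ring.
  - have : 0 < t1 * t by rewrite mulr_gt0.
    have : 0 <= D * u1 * u by rewrite !mulr_ge0 // ltW.
    lia.
  - by rewrite addr_ge0 // !mulr_ge0 // ltW.
have u_incr k : (z k).2 < (z k.+1).2.
  have [_ t0 u0] := zP k; rewrite {2}/z /= -/(z k).
  have : 0 < u1 * (z k).1 by rewrite mulr_gt0.
  have : (z k).2 <= t1 * (z k).2 by rewrite ler_peMl //; lia.
  lia.
have u_mono : {homo (fun k => (z k).2) : i j / (i < j)%N >-> i < j}.
  by apply: homo_ltn => // x y w; apply: lt_trans.
exists (fun k => (z k).1), (fun k => (z k).2); split=> [k|i j e].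
  by case: (zP k).
have [_ _ ui] := zP i; have [_ _ uj] := zP j.
move: e => /eqP; rewrite eqrXn2 // => /eqP e.
by case: (ltngtP i j) => // /u_mono; rewrite e ltxx.
Qed.
End Pell.

(** * Linear algebra *)

(** This is the value of a form at [a *~ N + y], as a polynomial in [N] with positive leading
    coefficient. *)
Lemma dominant_square (al g y : int) : 0 < al ->
  exists N : int, 0 < N * N * al + 2 * (N * g) + y.
Proof.
move=> al0; exists (1 + 2 * `|g| + `|y|).
have : 0 <= `|g| by []. have : 0 <= `|y| by [].
have : - `|g| <= g by lia.  have : - `|y| <= y by lia.
move: `|g| `|y| => c d h1 h2 c0 d0; set N := _ + d.
have N1 : 1 <= N by rewrite /N; lia.
have h3 : N * N <= N * N * al by rewrite ler_peMr ?mulr_ge0 //; lia.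
have h4 : 0 <= N * (g + c) by rewrite mulr_ge0 //; lia.
have h5 : 0 <= (N - 1) * d by rewrite mulr_ge0 //; lia.
have -> : N * N * al + 2 * (N * g) + y =
  (N * N * al - N * N) + 2 * (N * (g + c)) + (N - 1) * d + N + (y + d).
  by rewrite /N; ring.
by move: h3 h4 h5; move: (N * N * al) (N * N) (N * (g + c)) ((N - 1) * d) => *; lia.
Qed.

Lemma clear_denominators n (u : 'rV[rat]_n) :
  exists (d : int) (v : 'rV[int]_n), d != 0 /\ map_mx intr v = d%:~R *: u.
Proof.
exists (\prod_i denq (u 0 i)), (\row_j (numq (u 0 j) * \prod_(i | i != j) denq (u 0 i))).
split; first by apply/prodf_neq0 => i _; rewrite denq_neq0.
apply/rowP => j; rewrite !mxE [in RHS](bigD1 j) //= !intrM.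
by rewrite numqE [RHS]mulrC mulrA.
Qed.

(** Completing the square: the corner entry is the value at the first basis vector, hence a positive
    pivot, and the induction continues with its Schur complement. No square root is taken, so the
    argument runs over the rationals. *)
Lemma posdef_diagonalization (F : realFieldType) n (G : 'M[F]_n) : G^T = G ->
  (forall u : 'rV_n, u != 0 -> 0 < (u *m G *m u^T) 0 0) ->
  exists (P : 'M[F]_n) (d : 'rV[F]_n),
    [/\ P \in unitmx, forall i, 0 < d 0 i & P *m G *m P^T = diag_mx d].
Proof.
elim: n G => [|n IH] G Gsym Gpos.
  exists 1%:M, 0; split; first exact: unitmx1.
    by case.
  by apply/matrixP => -[].
rewrite -[n.+1]/(1 + n)%N in G Gsym Gpos *.
pose a := G 0 0; pose b := ursubmx G; pose C := drsubmx G.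
have Ga : ulsubmx G = a%:M.
  by rewrite [LHS]mx11_scalar; congr (_%:M); rewrite !mxE; congr (G _ _); apply: val_inj.
have GE : G = block_mx a%:M b b^T C.
  by rewrite -[LHS]submxK Ga -[dlsubmx G]trmxK trmx_dlsub Gsym.
have a0 : 0 < a.
  have e0 : delta_mx 0 0 != 0 :> 'rV[F]_(1 + n).
    by apply/eqP => /rowP /(_ 0) /eqP; rewrite !mxE !eqxx oner_eq0.
  by have := Gpos _ e0; rewrite -rowE trmx_delta -colE !mxE.
pose T : 'M[F]_(1 + n) := block_mx 1%:M 0 (- a^-1 *: b^T) 1%:M.
pose G' := C - a^-1 *: (b^T *m b).
have TG : T *m G *m T^T = block_mx a%:M 0 0 G'.
  rewrite GE /T tr_block_mx !mulmx_block !trmx0 !trmx1 !mul1mx !mul0mx.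
  rewrite !addr0 !mulmx1 !mulmx0 !addr0.
  rewrite linearZ /= trmxK mul_mx_scalar mul_scalar_mx !scalerA mulrN divff ?gt_eqF //.
  by rewrite !scaleN1r !addNr mul0mx add0r -scalemxAl scaleNr addrC.
have G'sym : G'^T = G'.
  by rewrite linearB linearZ /= trmx_mul trmxK /C trmx_drsub Gsym.
(* The value of [G'] at [u] is the value of [G] at [row_mx 0 u *m T]. *)
have G'pos (u : 'rV_n) : u != 0 -> 0 < (u *m G' *m u^T) 0 0.
  move=> u0; have uT : row_mx 0 u *m T != 0.
    rewrite /T mul_row_block !mul0mx !add0r mulmx1 row_mx_eq0 negb_and u0 orbT //.
  have := Gpos _ uT; rewrite trmx_mul !mulmxA.
  rewrite -(mulmxA _ T) -(mulmxA _ (T *m G)) TG mul_row_block tr_row_mx mul_row_col.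
  by rewrite !mul0mx !mulmx0 !addr0 !add0r mul0mx add0r.
have [P [d [Pu d0 PE]]] := IH G' G'sym G'pos.
pose B : 'M[F]_(1 + n) := block_mx 1%:M 0 0 P.
exists (B *m T), (row_mx a%:M d); split.
- rewrite unitmx_mul /B /T !unitmxE det_ublock det_lblock !det1 !mul1r unitr1 andbT.
  by rewrite -unitmxE.
- move=> i; case: (splitP i) => j ij.
    rewrite (_ : i = lshift n j); last exact: val_inj.
    by rewrite row_mxEl (ord1 j) mxE eqxx mulr1n.
  by rewrite (_ : i = rshift 1 j) ?row_mxEr //; apply: val_inj.
- rewrite trmx_mul !mulmxA -(mulmxA _ T) -(mulmxA _ (T *m G)) TG /B tr_block_mx.
  rewrite !mulmx_block !trmx0 trmx1 !mul0mx !mulmx0 !addr0 !add0r !mul1mx !mulmx1 PE.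
  rewrite diag_mx_row; congr block_mx.
  by apply/matrixP => i j; rewrite (ord1 i) (ord1 j) !mxE !eqxx.
  exact: mul0mx.
Qed.

Lemma Zbasis_injective (Lambda : zmodType) n (e : 'I_n -> Lambda) (c d : {ffun 'I_n -> int}) :
  is_Zbasis e -> \sum_i e i *~ c i = \sum_i e i *~ d i -> c = d.
Proof.
move=> eB cd; have [z [_ zu]] := eB (\sum_i e i *~ c i).
by rewrite -(zu c) // -(zu d).
Qed.

Lemma zmod_morphism_mulz (V W : zmodType) (f : V -> W) :
  zmod_morphism f -> forall k, {morph f : x / x *~ k}.
Proof.
move=> fB k x.
pose g : {additive V -> W} := HB.pack f (GRing.isZmodMorphism.Build _ _ f fB).
exact: (raddfMz g).
Qed.

Lemma zmod_morphismD (V W : zmodType) (f : V -> W) :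
  zmod_morphism f -> {morph f : x y / x + y}.
Proof.
move=> fB; pose g : {additive V -> W} := HB.pack f (GRing.isZmodMorphism.Build _ _ f fB).
exact: (raddfD g).
Qed.

Lemma zmod_morphism0 (V W : zmodType) (f : V -> W) : zmod_morphism f -> f 0 = 0.
Proof. by move=> fB; rewrite -(subrr 0) fB !subrr. Qed.

(** * Automorphisms of symmetric bilinear forms *)

Section Form.
Variables (Lambda : zmodType) (Gamma : Lambda -> Lambda -> int).
Hypothesis bilinear : is_bilinear_form Gamma.
Hypothesis symmetric : is_symmetric_form Gamma.

Lemma formDl x y z : Gamma (x + y) z = Gamma x z + Gamma y z.
Proof. exact: (zmod_morphismD (bilinear.1 z)). Qed.

Lemma formDr x y z : Gamma x (y + z) = Gamma x y + Gamma x z.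
Proof. exact: (zmod_morphismD (bilinear.2 x)). Qed.

Lemma formBl x y z : Gamma (x - y) z = Gamma x z - Gamma y z.
Proof. exact: (bilinear.1 z). Qed.

Lemma formBr x y z : Gamma x (y - z) = Gamma x y - Gamma x z.
Proof. exact: (bilinear.2 x). Qed.

Lemma formMzl x k y : Gamma (x *~ k) y = k * Gamma x y.
Proof. by rewrite (zmod_morphism_mulz (bilinear.1 y)) mulrzz mulrC. Qed.

Lemma formMzr x k y : Gamma x (y *~ k) = k * Gamma x y.
Proof. by rewrite (zmod_morphism_mulz (bilinear.2 x)) mulrzz mulrC. Qed.

Lemma form0l y : Gamma 0 y = 0.
Proof. exact: zmod_morphism0 (bilinear.1 y). Qed.

Lemma form0r x : Gamma x 0 = 0.
Proof. exact: zmod_morphism0 (bilinear.2 x). Qed.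

Lemma formNl x y : Gamma (- x) y = - Gamma x y.
Proof. by rewrite -sub0r formBl form0l sub0r. Qed.

Lemma formNr x y : Gamma x (- y) = - Gamma x y.
Proof. by rewrite -sub0r formBr form0r sub0r. Qed.

Definition formE :=
  (formDl, formDr, formNl, formNr, formMzl, formMzr, form0l, form0r).

(** Injectivity of the adjoint map, which is one half of unimodularity. *)
Definition nondegenerate_form : Prop := forall x, (forall y, Gamma x y = 0) -> x = 0.

Lemma unimodular_nondegenerate : is_unimodular Gamma -> nondegenerate_form.
Proof.
move=> unim x x0; have := unim (fun=> 0) (fun _ _ => esym (subr0 0)).
case=> z [_ uz]; rewrite -(uz x) // -(uz 0) // => y; exact: form0l.
Qed.

Hypothesis nondeg : nondegenerate_form.

Lemma form_ext x y : (forall z, Gamma x z = Gamma y z) -> x = y.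
Proof.
move=> h; apply/eqP; rewrite -subr_eq0; apply/eqP/nondeg => z.
by rewrite formBl h subrr.
Qed.

Lemma form_witness (x : Lambda) : x != 0 -> exists y, Gamma x y != 0.
Proof.
move=> x0; apply: contrapT => h; case/eqP: x0; apply: nondeg => y.
by apply/eqP; apply: contrapT => /negP xy; apply: h; exists y.
Qed.

(** * Isometries from Pell's equation *)

Definition skew_map (a b x : Lambda) : Lambda := b *~ Gamma x a - a *~ Gamma x b.
(** Minus the Gram determinant of [a] and [b]. *)
Definition disc (a b : Lambda) : int := Gamma a b ^+ 2 - Gamma a a * Gamma b b.

(* [skew_map a b] satisfies [J ^ 3 = D J] for [D = disc a b], so that for
   [t ^ 2 - D u ^ 2 = 1] this is [exp (s J)], where [t + u sqrt D] is the
   exponential of [s sqrt D / 2]. *)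
Definition pell_aut (a b : Lambda) (t u : int) (x : Lambda) : Lambda :=
  x + skew_map a b (skew_map a b x) *~ (2 * u ^+ 2) + skew_map a b x *~ (2 * t * u).

(** [J] is skew and [J ^ 2] self-adjoint, so taking adjoints flips the sign of [u]. For solutions of
    Pell's equation the adjoint is the inverse. *)
Lemma pell_aut_adjoint a b t u x y :
  Gamma (pell_aut a b t u x) y = Gamma x (pell_aut a b t (- u) y).
Proof.
rewrite /pell_aut /skew_map !formE ?(symmetric b x) ?(symmetric a x).
by rewrite ?(symmetric b y) ?(symmetric a y) ?(symmetric b a); ring.
Qed.

Lemma pell_aut_isometry a b t u x y : t ^+ 2 - disc a b * u ^+ 2 = 1 ->
  Gamma (pell_aut a b t u x) (pell_aut a b t u y) = Gamma x y.
Proof.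
move=> tu; apply/eqP; rewrite -subr_eq0; apply/eqP.
(* The defect of isometry is [t ^ 2 - D u ^ 2 - 1] times this factor. *)
rewrite -[RHS](mul0r (4 * u ^+ 2 * Gamma (skew_map a b x) (skew_map a b y))).
rewrite -(subrr 1) -{1}tu /disc /pell_aut /skew_map !formE.
rewrite ?(symmetric b x) ?(symmetric a x) ?(symmetric b y) ?(symmetric a y).
by rewrite ?(symmetric b a); ring.
Qed.

Lemma pell_aut_autgrp a b t u : t ^+ 2 - disc a b * u ^+ 2 = 1 ->
  autgrp Gamma (pell_aut a b t u).
Proof.
move=> tu; have tu' : t ^+ 2 - disc a b * (- u) ^+ 2 = 1 by rewrite sqrrN.
split; last by move=> x y; apply: pell_aut_isometry.
  move=> x y; apply: form_ext => z.
  by rewrite /pell_aut /skew_map !formE; ring.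
exists (pell_aut a b t (- u)) => x; apply: form_ext => z.
  by rewrite pell_aut_adjoint opprK pell_aut_isometry.
by rewrite pell_aut_adjoint pell_aut_isometry.
Qed.

(** * Infinite orbits *)

Lemma infinite_pell_orbit a b x (t u : nat -> int) :
  (forall k, t k ^+ 2 - disc a b * u k ^+ 2 = 1) ->
  (forall i j, pell_aut a b (t i) (u i) x = pell_aut a b (t j) (u j) x -> i = j) ->
  infinite_set [set f x | f in autgrp Gamma].
Proof.
move=> tu inj /(sub_finite_set (A := range (fun k => pell_aut a b (t k) (u k) x))).
have h : range (fun k => pell_aut a b (t k) (u k) x) `<=` [set f x | f in autgrp Gamma].
  by move=> _ [k _ <-]; exists (pell_aut a b (t k) (u k)) => //; apply: pell_aut_autgrp.
move=> /(_ h) /(@finite_preimage _ _ _ (fun k => pell_aut a b (t k) (u k) x)) fin.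
apply: infinite_nat.
apply: sub_finite_set (fin _); first by move=> k _; exists k.
by move=> i j _ _; apply: inj.
Qed.

(** The part of the [k]-th image that is quadratic in [k] is a multiple of [Gamma x e] times [e], so
    its pairing with [z] vanishes in both cases. What remains is affine in [k], of slope
    [2 (x.e) (w.z)] or [- 2 (x.w) (e.z)]. *)
Lemma infinite_orbit_transvection e w x z :
  Gamma e e = 0 -> Gamma e w = 0 ->
  (Gamma x e != 0 /\ Gamma e z = 0 /\ Gamma w z != 0) \/
  (Gamma x e = 0 /\ Gamma x w != 0 /\ Gamma e z != 0) ->
  infinite_set [set f x | f in autgrp Gamma].
Proof.
move=> ee ew h.
apply: (@infinite_pell_orbit e w x (fun=> 1) (fun k => k%:Z)).
  by move=> k; rewrite /disc ee ew; ring.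
move=> i j /(congr1 (Gamma^~ z)); rewrite /pell_aut /skew_map.
rewrite !formE ee ew ?(symmetric w e) ew.
case: h => [[xe [ez wz]]|[xe [xw ez]]].
  move=> /eqP; rewrite ez -subr_eq0 => /eqP E.
  have : (Gamma x e * Gamma w z) * (i%:Z - j%:Z) = 0.
    by apply: (@mulfI _ 2) => //; rewrite mulr0 -[RHS]E; ring.
  by move=> /eqP; rewrite !mulf_eq0 (negPf xe) (negPf wz) /= subr_eq0 => /eqP [].
move=> /eqP; rewrite xe -subr_eq0 => /eqP E.
have : (Gamma x w * Gamma e z) * (i%:Z - j%:Z) = 0.
  by apply: (@mulfI _ (-2)) => //; rewrite mulr0 -[RHS]E; ring.
by move=> /eqP; rewrite !mulf_eq0 (negPf xw) (negPf ez) /= subr_eq0 => /eqP [].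
Qed.

(** If two images of [x] agree, then [A J ^ 2 x + B J x = 0], where [A] is the difference of the
    [u ^ 2] and [B] that of the [t u]. Applying [J] and using [J ^ 3 = D J] gives a second relation;
    eliminating [J ^ 2 x] leaves [B ^ 2 = D A ^ 2], so [A = 0]. *)
Lemma infinite_orbit_nonsquare (R : realType) a b x z : 0 < disc a b ->
  (forall s : int, s ^+ 2 != disc a b) -> Gamma (skew_map a b x) z != 0 ->
  infinite_set [set f x | f in autgrp Gamma].
Proof.
set D := disc a b => D0 Dns s1.
have [t [u [tu inj]]] := pell_sequence D0 Dns R.
apply: (infinite_pell_orbit tu) => i j E; apply: inj.
apply/eqP; apply: contrapT => /negP; rewrite -subr_eq0.
pose A : int := u i ^+ 2 - u j ^+ 2; rewrite -/A => A0.
pose B : int := t i * u i - t j * u j.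
have rel y : (u i ^+ 2 - u j ^+ 2) * Gamma (skew_map a b (skew_map a b x)) y +
    (t i * u i - t j * u j) * Gamma (skew_map a b x) y = 0 :> int.
  have /eqP := congr1 (Gamma^~ y) E; rewrite -subr_eq0 => /eqP Ey.
  by apply: (@mulfI _ 2) => //; rewrite mulr0 -[RHS]Ey /pell_aut /skew_map !formE; ring.
have := rel (skew_map a b z); have := rel z; rewrite -/A -/B.
have -> : Gamma (skew_map a b x) (skew_map a b z) = - Gamma (skew_map a b (skew_map a b x)) z.
  by rewrite /skew_map !formE ?(symmetric b z) ?(symmetric a z) ?(symmetric b a); ring.
have -> : Gamma (skew_map a b (skew_map a b x)) (skew_map a b z) =
    - (D * Gamma (skew_map a b x) z).
  by rewrite /D /disc /skew_map !formE ?(symmetric b z) ?(symmetric a z) ?(symmetric b a); ring.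
move: s1; set s1 := Gamma (skew_map a b x) z; set s2 := Gamma _ z => s10 r1 r2.
have AB : B ^+ 2 = D * A ^+ 2.
  apply: (mulIf s10); apply/eqP; rewrite -subr_eq0; apply/eqP.
  transitivity (B * (A * s2 + B * s1) + A * (A * - (D * s1) + B * - s2)); first by ring.
  by rewrite r1 r2 !mulr0 addr0.
by have [s sD] := int_sqr_quotient A0 AB; move: (Dns s); rewrite sD eqxx.
Qed.

(** The quadratic formula for the zeros of the form on the plane of [a] and [b]. *)
Lemma isotropic_of_square_disc (a b : Lambda) (s : int) :
  0 < Gamma a a -> Gamma b b < 0 -> s ^+ 2 = disc a b ->
  exists e : Lambda, e != 0 /\ Gamma e e = 0.
Proof.
move=> a0 b0 sD; exists (a *~ (s - Gamma a b) + b *~ Gamma a a); split; last first.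
  have := erefl (Gamma a a * (s ^+ 2 - disc a b)); rewrite {1}sD subrr mulr0.
  by rewrite /disc !formE ?(symmetric b a) => ->; ring.
(* Against the vector with the [b] coefficient negated, the mixed terms cancel and the pairing is
   positive. *)
apply/eqP => /(congr1 (fun v => Gamma v (a *~ (s - Gamma a b) - b *~ Gamma a a))).
rewrite !formE ?(symmetric b a).
have h1 : 0 <= (s - Gamma a b) ^+ 2 * Gamma a a by rewrite mulr_ge0 ?sqr_ge0 // ltW.
have h2 : Gamma a a ^+ 2 * Gamma b b < 0 by rewrite pmulr_rlt0 // exprn_gt0.
by move: h1 h2; rewrite !expr2; lia.
Qed.

(** The partner spans the second isotropic line in the plane of [e] and any [f] with
    [Gamma e f != 0]. *)
Lemma isotropic_partner (e : Lambda) : e != 0 -> Gamma e e = 0 ->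
  exists e', Gamma e' e' = 0 /\ Gamma e e' != 0.
Proof.
move=> e0 ee; have [f ef] := form_witness e0.
exists (f *~ (2 * Gamma e f) - e *~ Gamma f f); split.
  by rewrite !formE ee ?(symmetric f e); ring.
by rewrite !formE ee mulr0 subr0 !mulf_neq0.
Qed.

Lemma positive_not_orthogonal (x a : Lambda) : 0 < Gamma a a -> x != 0 ->
  exists a', 0 < Gamma a' a' /\ Gamma x a' != 0.
Proof.
move=> a0 x0; have [xa|xa] := eqVneq (Gamma x a) 0; last by exists a.
have [y xy] := form_witness x0.
have [N NP] := dominant_square (Gamma a y) (Gamma y y) a0.
exists (a *~ N + y); rewrite !formE xa mulr0 add0r; split=> //.
rewrite (symmetric y a).
rewrite (_ : _ + _ = N * N * Gamma a a + 2 * (N * Gamma a y) + Gamma y y) //.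
ring.
Qed.

(** As in Cramer's rule, [disc a b * Gamma x a] is a combination of the pairings of [J x] with [a]
    and [b]. *)
Lemma skew_neq0 x a b : disc a b != 0 -> Gamma x a != 0 ->
  exists z, Gamma (skew_map a b x) z != 0.
Proof.
move=> D0 xa; apply: contrapT => h.
have sk0 z : Gamma (skew_map a b x) z = 0.
  by apply/eqP; apply: contrapT => /negP hz; apply: h; exists z.
have : disc a b * Gamma x a = 0.
  have := erefl (Gamma a b * Gamma (skew_map a b x) a - Gamma a a * Gamma (skew_map a b x) b).
  rewrite {1}(sk0 a) {1}(sk0 b) !mulr0 subrr /disc /skew_map !formE ?(symmetric b a) => ->.
  ring.
by move=> /eqP; rewrite mulf_eq0 (negPf D0) (negPf xa).
Qed.

Lemma infinite_orbit (R : realType) (a b x : Lambda) :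
  (forall e e', exists w : Lambda, [/\ w != 0, Gamma e w = 0 & Gamma e' w = 0]) ->
  0 < Gamma a a -> Gamma b b < 0 -> x != 0 ->
  infinite_set [set f x | f in autgrp Gamma].
Proof.
move=> perp a0 b0 x0.
(* Without isotropic vectors [disc a' b] cannot be a square, and the Pell isometries apply. *)
have [[e [e0 ee]]|aniso] := EM (exists e : Lambda, e != 0 /\ Gamma e e = 0); last first.
  have [a' [a'0 xa]] := positive_not_orthogonal a0 x0.
  have D0 : 0 < disc a' b.
    have h1 : 0 <= Gamma a' b ^+ 2 by apply: sqr_ge0.
    have h2 : Gamma a' a' * Gamma b b < 0 by rewrite pmulr_rlt0.
    by rewrite /disc; lia.
  have [z zP] := skew_neq0 (lt0r_neq0 D0) xa.
  apply: (infinite_orbit_nonsquare R D0 _ zP) => s; apply/eqP => sD.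
  exact/aniso/(isotropic_of_square_disc a'0 b0 sD).
have [e' [ee' m0]] := isotropic_partner e0 ee.
(* Here [x] is not orthogonal to [f]. The transvection uses [w] orthogonal to [f] and [f'];
   correcting [z] by [f'] makes it orthogonal to [f] and only rescales its pairing with [w]. *)
have case1 f f' : Gamma f f = 0 -> Gamma f' f' = 0 -> Gamma f f' != 0 ->
    Gamma x f != 0 -> infinite_set [set f x | f in autgrp Gamma].
  move=> ff ff' f0 xf; have [w [w0 fw fw']] := perp f f'.
  have [z wz] := form_witness w0.
  apply: (infinite_orbit_transvection (e := f) (w := w)
    (z := z *~ Gamma f f' - f' *~ Gamma f z)) => //.
  left; split=> //; split; first by rewrite !formE; ring.
  by rewrite !formE (symmetric w f') fw' mulr0 subr0 mulf_neq0.
have [xe|xe] := eqVneq (Gamma x e) 0; last exact: (case1 e e').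
have [xe'|xe'] := eqVneq (Gamma x e') 0; last first.
  by apply: (case1 e' e) => //; rewrite symmetric.
(* Now [x] is orthogonal to [e] and [e'], so correcting [z] by [e'] makes it orthogonal to [e] and
   keeps its pairing with [x] nonzero. *)
have [z xz] := form_witness x0.
apply: (infinite_orbit_transvection (e := e) (z := e')
  (w := z *~ Gamma e e' - e' *~ Gamma e z)) => //; first by rewrite !formE; ring.
by right; split=> //; split=> //; rewrite !formE xe' mulr0 subr0 mulf_neq0.
Qed.

(** * Finite automorphism groups *)

Lemma finite_autgrp (k M : nat) (v : 'I_k -> Lambda) :
  (forall x, (forall i, Gamma x (v i) = 0) -> x = 0) ->
  (forall f, autgrp Gamma f -> forall i j, `|Gamma (f (v i)) (v j)| <= M%:Z) ->
  finite_set (autgrp Gamma).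
Proof.
move=> vnd bd.
pose F (f : Lambda -> Lambda) : {ffun 'I_k * 'I_k -> 'I_(M + M).+1} :=
  [ffun ij => inord (absz (Gamma (f (v ij.1)) (v ij.2) + M%:Z))].
apply: (@finite_set_inj _ _ _ F) => f g /set_mem Af /set_mem Ag /ffunP FG.
have fgv i : f (v i) = g (v i).
  apply/eqP; rewrite -subr_eq0; apply/eqP/vnd => j.
  have := FG (i, j); rewrite !ffunE /= => /inord_shift_inj E.
  by rewrite !formE E ?subrr //; exact: bd.
apply/funext => x; apply/eqP; rewrite -subr_eq0; apply/eqP.
have [fB [h fh hf] fG] := Af; have [gB _ gG] := Ag.
(* [f] and [g] agree on [v], so [f x - g x] is orthogonal to every [f (v i)]; pulled back by the
   inverse [h] of [f], it is orthogonal to every [v i]. *)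
rewrite -[LHS]hf; have -> : h (f x - g x) = 0; last exact: zmod_morphism0.
apply: vnd => i; rewrite -fG hf !formE fG fgv gG subrr //.
Qed.

(** The sign [eps] treats both semidefinite cases at once. *)
Lemma cauchy_schwarz (eps : int) x y : eps ^+ 2 = 1 ->
  (forall z, 0 <= eps * Gamma z z) ->
  Gamma x y ^+ 2 <= Gamma x x * Gamma y y.
Proof.
move=> eps2 psd.
have [y0|y0] := eqVneq (Gamma y y) 0.
  (* With [X = eps * Gamma x x] and [b = Gamma x y], this multiple of [y] gives
     [0 <= X - 2 b ^ 2 (X + 1)], which forces [b = 0]. *)
  have X0 := psd x; have := psd (x - y *~ (eps * Gamma x y * (eps * Gamma x x + 1))).
  rewrite (_ : eps * _ = eps * Gamma x x -
      2 * eps ^+ 2 * (Gamma x y ^+ 2 * (eps * Gamma x x + 1))); last first.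
    by rewrite !formE y0 (symmetric y x); ring.
  move: X0; set X := eps * Gamma x x => X0; set b := Gamma x y.
  rewrite eps2 => h.
  have [->|b0] := eqVneq b 0; first by rewrite y0 mulr0 expr0n.
  have b1 : 1 <= b ^+ 2 by rewrite -gtz0_ge1 exprn_even_gt0.
  have : 1 * (X + 1) <= b ^+ 2 * (X + 1) by rewrite ler_wpM2r //; lia.
  lia.
have yp : 0 < eps * Gamma y y.
  rewrite lt_neqAle psd andbT eq_sym mulf_neq0 //.
  by apply/eqP => e0; move: eps2; rewrite e0.
have := psd (x *~ Gamma y y - y *~ Gamma x y).
have -> : eps * Gamma (x *~ Gamma y y - y *~ Gamma x y)
    (x *~ Gamma y y - y *~ Gamma x y) =
  (eps * Gamma y y) * (Gamma x x * Gamma y y - Gamma x y ^+ 2).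
  by rewrite !formE (symmetric y x); ring.
by rewrite pmulr_rge0 // subr_ge0.
Qed.

Lemma Zbasis_nondegenerate n (e : 'I_n -> Lambda) x : is_Zbasis e ->
  (forall i, Gamma x (e i) = 0) -> x = 0.
Proof.
move=> eB x0; apply: nondeg => y; have [c [-> _]] := eB y.
elim/big_ind: _ => [|y1 y2 h1 h2|i _]; first by rewrite formE.
  by rewrite formE h1 h2.
by rewrite formE x0 mulr0.
Qed.

Lemma finite_autgrp_semidefinite (eps : int) n : free_of_rank Lambda n ->
  eps ^+ 2 = 1 -> (forall z, 0 <= eps * Gamma z z) ->
  finite_set (autgrp Gamma).
Proof.
move=> [e eB] eps2 psd.
pose N i j := absz (Gamma (e i) (e i) * Gamma (e j) (e j)).
apply: (@finite_autgrp n (\sum_i \sum_j N i j)%N e).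
  by move=> x; apply: Zbasis_nondegenerate.
move=> f [_ _ fG] i j; have := cauchy_schwarz (f (e i)) (e j) eps2 psd.
rewrite fG => h.
have : (N i j <= \sum_i \sum_j N i j)%N.
  by rewrite (bigD1 i) //= (bigD1 j) //= -addnA leq_addr.
rewrite /N; set S := (\sum_i _)%N; set X := _ * _ in h *; set g := Gamma _ _ in h * => le.
have : `|g| <= g ^+ 2.
  rewrite -(real_normK (num_real g)) expr2.
  by move: `|g| (normr_ge0 g); clear; nia.
lia.
Qed.

(** The [k]-th coordinate is a homomorphism to the integers, which unimodularity represents by an
    element. *)
Lemma Zbasis_dual n (e : 'I_n -> Lambda) (k : 'I_n) : is_Zbasis e ->
  is_unimodular Gamma -> exists u, forall i, Gamma u (e i) = (i == k)%:R.
Proof.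
move=> eB unim.
have coord x : exists c : {ffun 'I_n -> int}, x = \sum_i e i *~ c i.
  by have [d [xd _]] := eB x; exists d.
have [c cP] := choice coord.
have cB : zmod_morphism (fun x => c x k).
  move=> x y; have -> : c (x - y) = [ffun i => c x i - c y i].
    apply: (Zbasis_injective eB); rewrite -cP {1}(cP x) {1}(cP y) -sumrB.
    by apply: eq_bigr => i _; rewrite ffunE mulrzBr.
  by rewrite ffunE.
have [u [uP _]] := unim _ cB; exists u => i; rewrite uP.
have -> : c (e i) = [ffun j => (j == i)%:R].
  apply: (Zbasis_injective eB); rewrite -cP (bigD1 i) //= ffunE eqxx big1 ?addr0 //.
  by move=> j ji; rewrite ffunE (negPf ji).
by rewrite ffunE eq_sym.
Qed.

(** Two linear equations in at least three unknowns have a nonzero rational solution, which is then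
    made integral. *)
Lemma exists_orthogonal n (e1 e2 : Lambda) : free_of_rank Lambda n -> (3 <= n)%N ->
  exists w : Lambda, [/\ w != 0, Gamma e1 w = 0 & Gamma e2 w = 0].
Proof.
move=> [e eB] n3.
pose A : 'M[int]_(n, 2) := \matrix_(i, j) Gamma (if j == 0 then e1 else e2) (e i).
pose Aq := map_mx intr A : 'M[rat]_(n, 2).
have : kermx Aq != 0.
  rewrite -mxrank_eq0 mxrank_ker -lt0n subn_gt0.
  exact: leq_ltn_trans (rank_leq_col _) n3.
case/rowV0Pn => u /sub_kermxP uA u0.
have [d [v [d0 vu]]] := clear_denominators u.
have vA : v *m A = 0.
  have : map_mx intr (v *m A) = 0 :> 'rV[rat]_2.
    by rewrite map_mxM vu -scalemxAl uA scaler0.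
  move=> h; apply/rowP => j; move/rowP/(_ j): h; rewrite !mxE => /eqP.
  by rewrite intr_eq0 => /eqP.
have v0 : v != 0.
  apply/eqP => v0; case/eqP: u0; move: vu; rewrite v0 map_mx0 => /esym/eqP.
  by rewrite scaler_eq0 intr_eq0 (negPf d0) => /eqP.
pose w := \sum_i e i *~ [ffun i => v 0 i] i.
have wE z : Gamma z w = \sum_i v 0 i * Gamma z (e i).
  rewrite /w; elim/big_ind2: _ => [|x1 x2 y1 y2 h1 h2|i _]; first by rewrite formE.
    by rewrite formE h1 h2.
  by rewrite formE ffunE.
exists w; split.
- apply: contra_neq v0 => w0; apply/rowP => i.
  have /ffunP /(_ i) : [ffun i => v 0 i] = [ffun=> 0].
    apply: (Zbasis_injective eB); rewrite -/w w0 big1 // => j _.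
    by rewrite ffunE.
  by rewrite !ffunE mxE.
- rewrite wE; transitivity ((v *m A) 0 0); last by rewrite vA mxE.
  by rewrite mxE; apply: eq_bigr => i _; rewrite mxE.
- rewrite wE; transitivity ((v *m A) 0 1); last by rewrite vA mxE.
  by rewrite mxE; apply: eq_bigr => i _; rewrite mxE.
Qed.

(** In rank 1 all values [Gamma x x] are squares times one fixed integer, so they never have
    opposite signs. *)
Lemma indefinite_rank n a b : free_of_rank Lambda n ->
  0 < Gamma a a -> Gamma b b < 0 -> (2 <= n)%N.
Proof.
case: n => [|[|n]] [e eB] a0 b0 //.
  have [c [aE _]] := eB a; move: a0; rewrite aE big_ord0 formE ltxx //.
have [c [aE _]] := eB a; have [d [bE _]] := eB b.
move: a0 b0; rewrite aE bE !big_ord_recl !big_ord0 !addr0 !formE.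
set g := Gamma _ _; rewrite !mulrA -!expr2 => h1 h2.
have cg := sqr_ge0 (c ord0); have dg := sqr_ge0 (d ord0).
have g0 : 0 < g by rewrite ltNge; apply/negP => /(mulr_ge0_le0 cg); rewrite leNgt h1.
by have := mulr_ge0 dg (ltW g0); rewrite leNgt h2.
Qed.

(** An automorphism preserves or swaps the isotropic lines of [e] and [e']: the identity [mE] yields
    [A B = 0], [C D = 0] and [A D + B C = m ^ 2]. The two nonzero numbers thus have product [m ^ 2]
    and are bounded by it. *)
Lemma finite_autgrp_hyperbolic e e' :
  Gamma e e = 0 -> Gamma e' e' = 0 -> Gamma e e' != 0 ->
  (forall w, Gamma w e = 0 -> Gamma w e' = 0 -> w = 0) ->
  finite_set (autgrp Gamma).
Proof.
move=> ee ee' m0 nd; set m := Gamma e e' in m0.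
have mE v w : m * Gamma v w = Gamma v e * Gamma w e' + Gamma v e' * Gamma w e.
  have : v *~ m - (e' *~ Gamma v e + e *~ Gamma v e') = 0.
    by apply: nd; rewrite !formE ?ee ?ee' ?(symmetric e' e) -/m; ring.
  move=> /(congr1 (Gamma^~ w)); rewrite !formE (symmetric e w) (symmetric e' w).
  by move=> /eqP; rewrite subr_eq0 => /eqP.
apply: (@finite_autgrp 2 (absz (m ^+ 2)) (fun i => if i == 0 then e else e')).
  by move=> x xv; apply: nd; [exact: (xv 0)|exact: (xv 1)].
move=> f [_ _ fG].
have := mE (f e) (f e); have := mE (f e') (f e'); have := mE (f e) (f e').
rewrite !fG ee ee' -/m mulr0.
set A := Gamma (f e) e; set B := Gamma (f e) e';
set C := Gamma (f e') e; set D := Gamma (f e') e'.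
move=> h1 h2 h3.
have {}h3 : A * B = 0 by lia.
have {}h2 : C * D = 0 by lia.
have bound x y : x * y = m * m -> `|x| <= `|m ^+ 2|.
  move=> xy; have : `|x| * `|y| = `|m ^+ 2| by rewrite -normrM xy.
  have : y != 0.
    apply: contra_neq m0 => y0; apply/eqP; move/eqP: xy.
    by rewrite y0 mulr0 eq_sym mulf_eq0 orbb.
  rewrite -normr_gt0 gtz0_ge1 => y1 <-.
  by rewrite ler_peMr.
have {}bound : [/\ `|A| <= `|m ^+ 2|, `|B| <= `|m ^+ 2|, `|C| <= `|m ^+ 2| & `|D| <= `|m ^+ 2|].
  move: h3 => /eqP; rewrite mulf_eq0 => /orP [] /eqP X0.
    move: h1 h2; rewrite X0 mul0r add0r => h1 /eqP; rewrite mulf_eq0 => /orP [] /eqP Y0.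
      by case/negP: m0; move/eqP: h1; rewrite Y0 mulr0 mulf_eq0 orbb.
    by rewrite Y0 !normr0 !normr_ge0 (bound B C) // (bound C B) // mulrC.
  move: h1 h2; rewrite X0 mul0r addr0 => h1 /eqP; rewrite mulf_eq0 => /orP [] /eqP Y0.
    by rewrite Y0 !normr0 !normr_ge0 (bound A D) // (bound D A) // mulrC.
  by case/negP: m0; move/eqP: h1; rewrite Y0 mulr0 mulf_eq0 orbb.
case: bound => b1 b2 b3 b4 i j; rewrite abszE.
by case: (i == 0); case: (j == 0).
Qed.

Lemma finite_autgrp_rank2 a b : free_of_rank Lambda 2 -> is_unimodular Gamma ->
  0 < Gamma a a -> Gamma b b < 0 -> finite_set (autgrp Gamma).
Proof.
move=> [e eB] unim a0 b0.
have coord x : exists x0 x1, x = e 0 *~ x0 + e 1 *~ x1.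
  have [c [-> _]] := eB x; exists (c 0), (c 1).
  by rewrite !big_ord_recl big_ord0 addr0; congr (_ + e _ *~ c _); apply: val_inj.
have [u uP] := Zbasis_dual 0 eB unim; have [v vP] := Zbasis_dual 1 eB unim.
have [u0 [u1 uE]] := coord u; have [v0 [v1 vE]] := coord v.
have := uP 0; have := uP 1; have := vP 0; have := vP 1; rewrite uE vE !formE /=.
set p := Gamma (e 0) (e 0); set q := Gamma (e 0) (e 1); set r := Gamma (e 1) (e 1).
rewrite (symmetric (e 1) (e 0)) -/q => E1 E2 E3 E4.
(* The coordinates of the dual basis invert the Gram matrix, so its determinant is a unit. *)
have det1 : (u0 * v1 - u1 * v0) * (p * r - q ^+ 2) = 1.
  transitivity ((u0 * p + u1 * q) * (v0 * q + v1 * r) - (u0 * q + u1 * r) * (v0 * p + v1 * q)).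
    by ring.
  by rewrite E1 E2 E3 E4.
have discE x0 x1 y0 y1 : disc (e 0 *~ x0 + e 1 *~ x1) (e 0 *~ y0 + e 1 *~ y1) =
    (q ^+ 2 - p * r) * (x0 * y1 - x1 * y0) ^+ 2.
  by rewrite /disc !formE (symmetric (e 1) (e 0)) -/p -/q -/r; ring.
have D0 : 0 < disc a b.
  have h1 : 0 <= Gamma a b ^+ 2 by apply: sqr_ge0.
  have h2 : Gamma a a * Gamma b b < 0 by rewrite pmulr_rlt0.
  by rewrite /disc; lia.
(* Of the two units, [0 < disc a b] excludes -1; hence [disc a b] is a square by [discE]. *)
have detN : q ^+ 2 - p * r = 1.
  have [a1 [a2 aE]] := coord a; have [b1 [b2 bE]] := coord b.
  move: D0; rewrite aE bE discE; have := sqr_ge0 (a1 * b2 - a2 * b1).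
  move: (_ ^+ 2) => X X0.
  have : absz (p * r - q ^+ 2)%R = 1%N.
    have := congr1 absz det1; rewrite abszM => /eqP; rewrite muln_eq1 => /andP[_ /eqP //].
  move: (p * r) (q ^+ 2) => Y Z h; have [->|->] : Y = Z + 1 \/ Y = Z - 1 by lia.
    by rewrite (_ : Z - (Z + 1) = -1) ?mulN1r; lia.
  by lia.
have [s sD] : exists s, s ^+ 2 = disc a b.
  have [a1 [a2 aE]] := coord a; have [b1 [b2 bE]] := coord b.
  by exists (a1 * b2 - a2 * b1); rewrite aE bE discE detN mul1r.
have [f [f0 ff]] := isotropic_of_square_disc a0 b0 sD.
have [f' [ff' m0]] := isotropic_partner f0 ff.
apply: (finite_autgrp_hyperbolic ff ff' m0) => w wf wf'.
have [f1 [f2 fE]] := coord f; have [w1 [w2 wE]] := coord w.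
(* A vanishing [disc] makes the coordinates of [f] and [w] proportional; pairing with [f'] then
   kills those of [w]. *)
have : disc f w = 0 by rewrite /disc ff symmetric wf; ring.
rewrite fE wE discE detN mul1r => /eqP; rewrite expf_eq0 /= subr_eq0 => /eqP dep.
have k1 : f *~ w1 = w *~ f1.
  apply: form_ext => z; rewrite fE wE !formE mulrDr [RHS]mulrDr !mulrA.
  by rewrite (mulrC w1 f2) -dep; ring.
have k2 : f *~ w2 = w *~ f2.
  apply: form_ext => z; rewrite fE wE !formE mulrDr [RHS]mulrDr !mulrA.
  by rewrite (mulrC w2 f1) dep; ring.
have w10 : w1 = 0.
  have := congr1 (Gamma^~ f') k1; rewrite !formE wf' mulr0 => /eqP.
  by rewrite mulf_eq0 (negPf m0) orbF => /eqP.
have w20 : w2 = 0.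
  have := congr1 (Gamma^~ f') k2; rewrite !formE wf' mulr0 => /eqP.
  by rewrite mulf_eq0 (negPf m0) orbF => /eqP.
by rewrite w10 w20 !mulr0z addr0.
Qed.

(** * Definiteness and real diagonalizations *)

Lemma form_gram n (e : 'I_n -> Lambda) (c : 'I_n -> int) :
  let x := \sum_i e i *~ c i in
  Gamma x x = (\row_i c i *m gram Gamma e *m (\row_i c i)^T) 0 0.
Proof.
move=> x; have xE z : Gamma x z = \sum_i c i * Gamma (e i) z.
  rewrite /x; elim/big_ind2: _ => [|x1 x2 y1 y2 h1 h2|i _]; first by rewrite formE.
    by rewrite formE h1 h2.
  by rewrite formE.
rewrite xE mxE; apply: eq_bigr => i _; rewrite !mxE mulrC (symmetric _ x) xE.
by congr (_ * _); apply: eq_bigr => j _; rewrite !mxE.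
Qed.

Lemma definite_semidefinite (R : realType) : definite Gamma R ->
  exists eps : int, eps ^+ 2 = 1 /\ forall x, 0 <= eps * Gamma x x.
Proof.
move=> [bp [bm [[n [d [[d1 [e [P [eB Pu PE]]]] bpE bmE]]] bpm]]].
have [eps [eps2 deps]] : exists eps : int, eps ^+ 2 = 1 /\ forall i, d 0 i = eps%:~R.
  have : bp = 0%N \/ bm = 0%N by lia.
  case=> b0.
    exists (-1); split=> // i; case: (d1 i) => // di1.
    by have := card0_eq (esym (etrans (esym b0) bpE)) i; rewrite !inE di1 eqxx.
  exists 1; split=> // i; case: (d1 i) => // di1.
  by have := card0_eq (esym (etrans (esym b0) bmE)) i; rewrite !inE di1 eqxx.
exists eps; split=> // x; have [c [-> _]] := eB x.
rewrite form_gram -(ler0z R) intrM.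
pose cR : 'rV[R]_n := map_mx intr (\row_i c i).
(* The coordinates of [x] in the diagonalizing basis. *)
pose y := cR *m invmx P.
have -> : ((\row_i c i *m gram Gamma e *m (\row_i c i)^T) 0 0)%:~R =
    (y *m (P *m map_mx intr (gram Gamma e) *m P^T) *m y^T) 0 0 :> R.
  rewrite /y trmx_mul !mulmxA mulmxKV // -(mulmxA _ P^T) -trmx_mul mulVmx // trmx1 mulmx1.
  by rewrite /cR matrix.map_trmx -!map_mxM [in RHS]mxE.
rewrite PE; clearbody y; rewrite mul_mx_diag mxE mulr_sumr sumr_ge0 // => i _.
rewrite !mxE deps.
rewrite (_ : _ * _ = (eps ^+ 2)%:~R * (y 0 i) ^+ 2); last by rewrite rmorphXn /=; ring.
by rewrite eps2 mul1r sqr_ge0.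
Qed.

(** Cauchy-Schwarz puts every [x] with [Gamma x x = 0] into the radical, so the form is definite on
    [Lambda]. Clearing denominators extends this to rational vectors; hence the diagonalization is
    done over [rat] and only then rescaled over [R]. *)
Lemma semidefinite_definite (R : realType) (eps : int) n :
  free_of_rank Lambda n -> eps ^+ 2 = 1 -> (forall x, 0 <= eps * Gamma x x) ->
  definite Gamma R.
Proof.
move=> [e eB] eps2 psd.
have eps0 : eps != 0 by apply/eqP => e0; move: eps2; rewrite e0 expr0n.
have posdef x : x != 0 -> 0 < eps * Gamma x x.
  move=> x0; rewrite lt_neqAle psd andbT eq_sym mulf_neq0 //.
  apply: contra_neq x0 => xx; apply: nondeg => y.
  have := cauchy_schwarz x y eps2 psd.
  rewrite xx mul0r => h; apply/eqP; rewrite -sqrf_eq0 eq_le h sqr_ge0 //.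
pose G : 'M[rat]_n := eps%:~R *: map_mx intr (gram Gamma e).
have Gsym : G^T = G.
  rewrite linearZ /= matrix.map_trmx; congr (_ *: map_mx _ _).
  by apply/matrixP => i j; rewrite !mxE symmetric.
have Gpos (u : 'rV_n) : u != 0 -> 0 < (u *m G *m u^T) 0 0.
  move=> u0; have [d [v [d0 vu]]] := clear_denominators u.
  pose x := \sum_i e i *~ [ffun i => v 0 i] i.
  have x0 : x != 0.
    apply: contra_neq u0 => x0.
    have vv : [ffun i => v 0 i] = [ffun=> 0].
      apply: (Zbasis_injective eB); rewrite -/x x0 big1 // => j _.
      by rewrite ffunE.
    apply/eqP; have : d%:~R *: u == 0.
      rewrite -vu; apply/eqP/rowP => i; move/ffunP/(_ i): vv.
      by rewrite !ffunE !mxE => ->.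
    by rewrite scaler_eq0 intr_eq0 (negPf d0).
  have := posdef x x0; rewrite /x form_gram -(ltr0z rat) intrM.
  have -> : \row_i [ffun i => v 0 i] i = v by apply/rowP => i; rewrite mxE ffunE.
  have -> : ((v *m gram Gamma e *m v^T) 0 0)%:~R =
      (map_mx intr v *m map_mx intr (gram Gamma e) *m (map_mx intr v)^T) 0 0 :> rat.
    by rewrite matrix.map_trmx -!map_mxM [in RHS]mxE.
  rewrite vu linearZ /= -!scalemxAl -scalemxAr /G -scalemxAr -scalemxAl !mxE.
    set S := \sum_j _.
  rewrite (_ : _ * _ = d%:~R ^+ 2 * (eps%:~R * S)); last by ring.
  by rewrite pmulr_rgt0 // exprn_even_gt0 //= intr_eq0.
have [P [q [Pu q0 PE]]] := posdef_diagonalization Gsym Gpos.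
(* Scaling by inverse square roots turns the positive entries [q] into 1, hence those of [Gamma]
   into [eps]. *)
pose s : 'rV[R]_n := \row_i (Num.sqrt (ratr (q 0 i)))^-1.
pose Q := diag_mx s *m map_mx ratr P.
have gramE : map_mx intr (gram Gamma e) = eps%:~R *: map_mx ratr G :> 'M[R]_n.
  apply/matrixP => i j; rewrite !mxE rmorphM /= !ratr_int mulrA -intrM.
  by rewrite -expr2 eps2 mul1r.
have QE : Q *m map_mx intr (gram Gamma e) *m Q^T = diag_mx (const_mx eps%:~R).
  rewrite gramE -scalemxAr -scalemxAl /Q trmx_mul tr_diag_mx matrix.map_trmx !mulmxA.
  rewrite -(mulmxA _ (map_mx _ P)) -map_mxM -(mulmxA _ (map_mx _ _) (map_mx _ _)) -map_mxM PE.
  rewrite map_diag_mx !mulmx_diag -linearZ /=; congr diag_mx; apply/rowP => i; rewrite !mxE.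
  have sq : Num.sqrt (ratr (q 0 i)) ^+ 2 = ratr (q 0 i) :> R by rewrite sqr_sqrtr // ler0q ltW.
  have sq0 : Num.sqrt (ratr (q 0 i)) != 0 :> R by rewrite gt_eqF // sqrtr_gt0 ltr0q.
  by rewrite -[X in _ * X * _]sq; field.
pose d : 'rV[R]_n := const_mx eps%:~R.
have dE i : d 0 i = eps%:~R by rewrite mxE.
have epsE : eps = 1 \/ eps = -1.
  by move/eqP: eps2; rewrite sqrf_eq1 => /orP [] /eqP; [left | right].
exists #|[pred i | d 0 i == 1]|, #|[pred i | d 0 i == -1]|; split.
  exists n, d; split=> //; split.
    by move=> i; rewrite dE; case: epsE => ->; [left | right].
  exists e, Q; split=> //; rewrite unitmx_mul map_unitmx Pu andbT.
  rewrite unitmxE det_diag unitfE; apply/prodf_neq0 => i _.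
  by rewrite mxE invr_neq0 // gt_eqF // sqrtr_gt0 ltr0q.
have m1 : (-1 == 1 :> R) = false by apply/eqP; lra.
case: epsE => eps1; [rewrite minnC | ]; rewrite [X in minn X _]eq_card0 ?min0n // => i.
  by rewrite !inE dE eps1 eq_sym m1.
by rewrite !inE dE eps1 m1.
Qed.

Lemma indefinite_signs (R : realType) n :
  free_of_rank Lambda n -> indefinite Gamma R ->
  exists a b, 0 < Gamma a a /\ Gamma b b < 0.
Proof.
move=> free indef.
have [[a a0]|na] := EM (exists a, 0 < Gamma a a); last first.
  case: indef; apply: (@semidefinite_definite R (-1) n) => // x.
  by rewrite mulN1r oppr_ge0 leNgt; apply/negP => x0; apply: na; exists x.
have [[b b0]|nb] := EM (exists b, Gamma b b < 0); first by exists a, b.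
case: indef; apply: (@semidefinite_definite R 1 n) => // x.
by rewrite mul1r leNgt; apply/negP => x0; apply: nb; exists x.
Qed.

End Form.

(* If [D] has finite index, the orbit of [x] is covered by the finitely many
   sets [f @` S], where [f] runs over representatives of the cosets of [D]. *)
Lemma infinite_index_of_infinite_orbit (T : Type) (A D : set (T -> T)) (S : set T) x :
  D id -> finite_set S -> S x -> (forall d, D d -> d @` S = S) ->
  infinite_set [set f x | f in A] -> infinite_index A D.
Proof.
move=> Did Sfin Sx DS orb cosets; apply: orb.
apply: (@sub_finite_set _ _ (\bigcup_(C in left_cosets A D) [set c y | c in C & y in S])).
  move=> _ [f Af <-]; exists [set f \o d | d in D]; first by exists f.
  by exists f; [exists id | exists x].
apply: bigcup_finite => // _ [f Af <-].
apply: sub_finite_set (finite_image f Sfin) => _ [_ [d Dd <-] [y Sy <-]] /=.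
by exists (d y) => //; rewrite -(DS d Dd); exists y.
Qed.

(** * The dichotomy by definiteness and rank *)

Theorem theorem2p3 (R : realType) (Lambda : zmodType) (n : nat)
    (Gamma : Lambda -> Lambda -> int)
    (Lambda_free : free_of_rank Lambda n)
    (Gamma_bilinear : is_bilinear_form Gamma)
    (Gamma_symmetric : is_symmetric_form Gamma)
    (Gamma_unimodular : is_unimodular Gamma) :
  (finite_set (autgrp Gamma) <->
     definite Gamma R \/ (indefinite Gamma R /\ n = 2%N)) /\
  ((infinite_set (autgrp Gamma) <-> indefinite Gamma R /\ (3 <= n)%N) /\
   (infinite_set (autgrp Gamma) ->
    forall D : set (Lambda -> Lambda), is_subgroup (autgrp Gamma) D ->
    (exists S : set Lambda,
       [/\ S !=set0, finite_set S,
           forall x, S x -> x <> 0 /\ characteristic Gamma x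
         & forall d, D d -> d @` S = S]) ->
    infinite_index (autgrp Gamma) D)).
Proof.
have nondeg := unimodular_nondegenerate Gamma_bilinear Gamma_unimodular.
have signs : indefinite Gamma R -> exists a b, 0 < Gamma a a /\ Gamma b b < 0.
  exact: (indefinite_signs Gamma_bilinear Gamma_symmetric nondeg Lambda_free).
have orbit : indefinite Gamma R -> (3 <= n)%N ->
    forall x, x != 0 -> infinite_set [set f x | f in autgrp Gamma].
  move=> /signs [a [b [a0 b0]]] n3 x x0.
  apply: (infinite_orbit Gamma_bilinear Gamma_symmetric nondeg R _ a0 b0 x0) => e1 e2.
  exact: (exists_orthogonal Gamma_bilinear e1 e2 Lambda_free n3).
have fin_def : definite Gamma R -> finite_set (autgrp Gamma).
  move=> /(definite_semidefinite Gamma_bilinear Gamma_symmetric) [eps [eps2 psd]].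
  exact: (finite_autgrp_semidefinite Gamma_bilinear Gamma_symmetric nondeg Lambda_free
    eps2 psd).
have fin2 : indefinite Gamma R -> n = 2%N -> finite_set (autgrp Gamma).
  move=> /signs [a [b [a0 b0]]] n2; rewrite n2 in Lambda_free.
  exact: (finite_autgrp_rank2 Gamma_bilinear Gamma_symmetric nondeg Lambda_free
    Gamma_unimodular a0 b0).
have inf : indefinite Gamma R -> (3 <= n)%N -> infinite_set (autgrp Gamma).
  move=> indef n3; have [a [b [a0 _]]] := signs indef.
  have a_neq0 : a != 0.
    by apply: contraTneq a0 => ->; rewrite (formE Gamma_bilinear) ltxx.
  by move=> fin; apply: (orbit indef n3 a a_neq0); apply: finite_image.
have rank2 : indefinite Gamma R -> (2 <= n)%N.
  by move=> /signs [a [b [a0 b0]]]; apply: (indefinite_rank Gamma_bilinear Lambda_free a0 b0).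
have inf_iff : infinite_set (autgrp Gamma) <-> indefinite Gamma R /\ (3 <= n)%N.
  split=> [infA|[]//]; have indef : indefinite Gamma R by move=> /fin_def.
  (* Indefiniteness gives rank at least 2, and rank 2 is excluded by [fin2]. *)
  split=> //; rewrite ltn_neqAle rank2 // andbT eq_sym.
  by apply/eqP => n2; apply/infA/fin2.
split; last split=> // infA D [_ Did _ _] [S [[x Sx] Sfin Snz DS]].
  split=> [finA|[/fin_def//|[indef n2]]]; last exact: fin2.
  have [|indef] := EM (definite Gamma R); [by left | right; split=> //].
  have := rank2 indef; rewrite leq_eqVlt => /orP [/eqP //|n3].
  by have := inf indef n3.
have [indef n3] := inf_iff.1 infA.
apply: (infinite_index_of_infinite_orbit Did Sfin Sx DS).
by apply: orbit => //; apply/eqP; have [] := Snz x Sx.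
Qed.
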